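(* In base $b=2$, every natural number can be taken to a single digit in at most two applications of the partition and sum operation. For every integer base $b\ge 3$, every natural number can be taken to a single digit in at most three applications of the partition and sum operation (all applications being carried out in the base $b$).
   Context: Fix an integer base $b\ge 2$. One application (one step) of the ''partition and sum'' operation to a natural number $n$ consists of the following: write $n$ in base $b$ as its string of digits, insert plus signs between some of the consecutive digits (as many or as few as desired), read each resulting block of consecutive digits as a number in base $b$ (blocks may have leading zeros), and replace $n$ by the sum of these blocks. The positions of the plus signs are chosen freely at each step, and the same base $b$ is used throughout. A number is a single digit (in base $b$) if it is less than $b$. ''Can be taken to a single digit in at most $s$ applications'' means that there is some choice of plus signs at each step such that after at most $s$ steps the result is a single digit. *)

(* Defs.v *)
From mathcomp Require Import all_boot.

Set Implicit Arguments.
Unset Strict Implicit.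
Unset Printing Implicit Defensive.

(* Most significant digit first, no leading zero; [digits b 0] is [:: 0].
   Meaningful for 1 < b, where a number n > 0 has (trunc_log b n).+1 digits. *)
Definition digits (b n : nat) : seq nat :=
  rev (mkseq (fun i => (n %/ b ^ i) %% b) (trunc_log b n).+1).

(* Leading zeros are allowed in [s]. *)
Definition block_value (b : nat) (s : seq nat) : nat :=
  foldl (fun v d => v * b + d) 0 s.

(* Placing plus signs in the digit string amounts to cutting it into nonempty
   consecutive blocks; a single block (no plus sign) is allowed. *)
Definition partition_sum (b n m : nat) : Prop :=
  exists blocks : seq (seq nat),
    [/\ flatten blocks = digits b n,
        [::] \notin blocks &
        m = \sum_(blk <- blocks) block_value b blk].

Fixpoint partition_sum_iter (b k n m : nat) : Prop :=
  if k is k'.+1 then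
    exists2 p, partition_sum b n p & partition_sum_iter b k' p m
  else n = m.

Definition single_digit_within (b s n : nat) : Prop :=
  exists k m, [/\ k <= s, partition_sum_iter b k n m & m < b].

(* Main.v *)
Require Import Defs.
From mathcomp Require Import all_boot.
From mathcomp Require Import zify.

Set Implicit Arguments.
Unset Strict Implicit.
Unset Printing Implicit Defensive.

(** The total of a digit string can be tuned in small steps. Cutting the string
    into single digits gives the digit sum [S]; gluing a digit [d] to its right
    neighbour adds [d * b.-1] to the total, hence at most [b.-1 ^ 2]. Disjoint
    glued pairs can be led either by the digits in even places or by those in
    odd places, and one of these two choices raises the total to about
    [S * b.+1 / 2]. So the totals obtained from pairs meet every window of
    length [b.-1 ^ 2] between these two values ([pairs_meet_window]).

    Base at least 3. Windows starting at [b ^ k] or [2 * b ^ k], with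
    [2 <= k], consist of numbers of digit sum at most [2 * b - 2]
    ([digit_sum_window]), and from such a number two applications of the digit
    sum finish. Numbers below [b ^ 2] have such a digit sum too. Consecutive window
    starts are in ratio 2 or [b / 2], so if [b ^ 2 <= S] one of these windows
    either contains [S] or starts between [S] and [S * b.+1 / 2].

    Base 2. A power of 2 has digit sum 1, so it suffices to reach a power of 2
    in one application. Windows have length 1, so pairs give every exact total
    up to about [3 * S / 2]; the next power of 2 may be as far as [2 * S - 2].
    Blocks of three digits add 3 or 4 each and raise the total by at least 4/3
    per digit 1 that they use; taking them greedily until the deficit is at most
    3, then pairs, is enough once [6 <= S] ([bits_reach]). The remaining delicate
    case is [S = 5], where, apart from leading zeros, 8 is missed only by the
    string 11111, which gives 1111 + 1 = 16. *)

(** * Totals of the cuttings of a digit string *)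

(** The operation on a string rather than on a number, so that strings can be
    treated piece by piece: [partition_sum b n] is [cuts_to b (digits b n)]. *)
Definition cuts_to (b : nat) (s : seq nat) (v : nat) : Prop :=
  exists blocks : seq (seq nat),
    [/\ flatten blocks = s, [::] \notin blocks &
        v = \sum_(blk <- blocks) block_value b blk].

Lemma cuts_to_block b x s : cuts_to b (x :: s) (block_value b (x :: s)).
Proof. by exists [:: x :: s]; rewrite /= cats0 big_seq1. Qed.

Lemma cuts_to_cat b s1 s2 v1 v2 :
  cuts_to b s1 v1 -> cuts_to b s2 v2 -> cuts_to b (s1 ++ s2) (v1 + v2).
Proof.
move=> [B1 [<- ne1 ->]] [B2 [<- ne2 ->]]; exists (B1 ++ B2).
by rewrite flatten_cat mem_cat negb_or ne1 ne2 big_cat.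
Qed.

Lemma cuts_to_cons b x s v : cuts_to b s v -> cuts_to b (x :: s) (x + v).
Proof. by move=> /(cuts_to_cat (cuts_to_block b x [::])). Qed.

Lemma cuts_to_pair b x y s v :
  cuts_to b s v -> cuts_to b (x :: y :: s) (x * b + y + v).
Proof. by move=> /(cuts_to_cat (cuts_to_block b x [:: y])). Qed.

Lemma cuts_to_triple b x y z s v :
  cuts_to b s v -> cuts_to b [:: x, y, z & s] ((x * b + y) * b + z + v).
Proof. by move=> /(cuts_to_cat (cuts_to_block b x [:: y; z])). Qed.

Lemma cuts_to_sumn b s : cuts_to b s (sumn s).
Proof.
elim: s => [|x s IH]; first by exists [::]; rewrite big_nil.
exact: cuts_to_cons.
Qed.

(** * Gluing disjoint pairs of digits *)

(** The sum of the leading digits when the string is cut from the left into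
    pairs; a last unpaired digit leads nothing. *)
Fixpoint lead_sum (s : seq nat) : nat :=
  if s is x :: y :: s' then x + lead_sum s' else 0.

(** Every digit except the last leads a pair in exactly one of the two
    pairings, which start at the first and at the second digit. *)
Lemma lead_sum_behead s : lead_sum s + lead_sum (behead s) + last 0 s = sumn s.
Proof.
case: s => // x s; elim: s x => [|y s IH] x /=; first lia.
by have := IH y; rewrite /=; lia.
Qed.

(** Greedy choice: glue pairs from the left as long as the total stays below
    [W], or until one gluing makes it jump over [W], by less than its increment
    [x * b.-1]. *)
Lemma lead_sum_window b s W : 1 < b -> all (fun d => d < b) s ->
  sumn s <= W <= sumn s + b.-1 * lead_sum s ->
  exists2 v, cuts_to b s v & W <= v < W + b.-1 ^ 2.
Proof.
move=> b_gt1; have win_gt0 : 0 < b.-1 ^ 2 by rewrite expn_gt0; lia.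
elim: {s}(size s).+1 {-2}s (ltnSn (size s)) W => // n IH [|x [|y s]] size_s W.
- by move=> _ /= ?; exists 0; [exact: (cuts_to_sumn b [::]) | lia].
- by move=> _ /= ?; exists x; [exact: (cuts_to_block b x [::]) | lia].
move=> /= /and3P[x_lt y_lt s_lt] W_bounds.
have incr_le : x * b.-1 <= b.-1 ^ 2 by rewrite -mulnn leq_mul2r; lia.
have glue : x * b = x + x * b.-1 by nia.
case: (ltnP W (x * b + y + sumn s)) => [W_lt | W_ge].
  case: (leqP W (x + (y + sumn s))) => [W_le | W_gt].
    by exists (x + (y + sumn s)); [exact: (cuts_to_sumn b [:: x, y & s]) | lia].
  by exists (x * b + y + sumn s); [exact/cuts_to_pair/cuts_to_sumn | lia].
have [||v v_s v_W] := IH s _ (W - (x * b + y)) s_lt.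
- by move: size_s => /=; lia.
- by move: W_bounds; rewrite mulnDr (mulnC b.-1 x); lia.
by exists (x * b + y + v); [exact: cuts_to_pair | lia].
Qed.

Lemma pairs_meet_window b s W : 1 < b -> all (fun d => d < b) s ->
  sumn s <= W <= sumn s + b.-1 * uphalf (sumn s - b.-1) ->
  exists2 v, cuts_to b s v & W <= v < W + b.-1 ^ 2.
Proof.
move=> b_gt1 s_lt W_bounds.
have last_lt : last 0 s <= b.-1.
  case: (s) s_lt => [|x s'] // /allP s_lt.
  by have := s_lt _ (mem_last x s'); rewrite /=; lia.
have lead := lead_sum_behead s.
case: (leqP (uphalf (sumn s - b.-1)) (lead_sum s)) => [big_s | small_s].
  apply: lead_sum_window => //.
  by have := leq_mul (leqnn b.-1) big_s; lia.
(* The pairing from the first digit is too light, so use the other one. *)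
case: s => [|x s] in s_lt W_bounds last_lt lead small_s *.
  by move: small_s => /=; lia.
have big_s : uphalf (sumn (x :: s) - b.-1) <= lead_sum s.
  by move: lead; rewrite [behead _]/=; lia.
have [||v v_s v_W] := @lead_sum_window b s (W - x) b_gt1.
- by case/andP: s_lt.
- by have := leq_mul (leqnn b.-1) big_s; move: W_bounds => /=; lia.
exists (x + v); first exact: cuts_to_cons.
by move: W_bounds v_W => /=; lia.
Qed.

(** * Digit sums *)

Definition digit_sum (b n : nat) : nat := sumn (digits b n).

Lemma all_digits_lt b n : 0 < b -> all (fun d => d < b) (digits b n).
Proof.
move=> b_gt0; rewrite all_rev; apply/allP => _ /mapP[i _ ->].
exact: ltn_pmod.
Qed.

Lemma digits_small b n : n < b -> digits b n = [:: n].
Proof.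
move=> n_lt; rewrite /digits.
have -> : trunc_log b n = 0 by apply/eqP; rewrite trunc_log_eq0; lia.
by rewrite /mkseq /= expn0 divn1 modn_small.
Qed.

Lemma digits_rcons b q r : 1 < b -> 0 < q -> r < b ->
  digits b (q * b + r) = rcons (digits b q) r.
Proof.
move=> b_gt1 q_gt0 r_lt; rewrite /digits.
have div_b : (q * b + r) %/ b = q by rewrite divnMDl ?divn_small ?addn0 //; lia.
have -> : trunc_log b (q * b + r) = (trunc_log b q).+1.
  have /andP[low high] := trunc_log_bounds b_gt1 q_gt0.
  apply: trunc_log_eq => //; rewrite [_ ^ _.+2]expnSr [X in X <= _]expnSr.
  have := leq_mul low (leqnn b); have := leq_mul high (leqnn b).
  by rewrite mulSn; lia.
rewrite /mkseq.
have -> K : iota 0 K.+1 = 0 :: iota (1 + 0) K by [].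
rewrite iotaDl map_cons -map_comp.
rewrite rev_cons expn0 divn1 modnMDl modn_small //; congr (rcons (rev _) r).
by apply: eq_map => i /=; rewrite add1n expnS divnMA div_b.
Qed.

Lemma digit_sumE b q r : 1 < b -> r < b ->
  digit_sum b (q * b + r) = digit_sum b q + r.
Proof.
move=> b_gt1 r_lt; case: (posnP q) => [-> | q_gt0].
  by rewrite /digit_sum mul0n !digits_small //=; lia.
by rewrite /digit_sum digits_rcons // sumn_rcons.
Qed.

Lemma digit_sum_small b n : n < b -> digit_sum b n = n.
Proof. by move=> n_lt; rewrite /digit_sum digits_small //= addn0. Qed.

Lemma digit_sum_shift b k a x : 1 < b -> x < b ^ k ->
  digit_sum b (a * b ^ k + x) = digit_sum b a + digit_sum b x.
Proof.
move=> b_gt1; elim: k x => [|k IH] x x_lt.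
  have -> : x = 0 by move: x_lt; rewrite expn0; lia.
  by rewrite muln1 addn0 (@digit_sum_small b 0) ?addn0 //; lia.
have b_gt0 : 0 < b by lia.
rewrite (divn_eq x b) expnSr mulnA addnA -mulnDl !digit_sumE ?ltn_pmod //.
by rewrite IH ?addnA // ltn_divLR // -expnSr.
Qed.

Lemma digit_sum_two_digits b m : 1 < b -> m < b ^ 2 ->
  digit_sum b m = m %/ b + m %% b.
Proof.
move=> b_gt1 m_lt; have b_gt0 : 0 < b by lia.
rewrite {1}(divn_eq m b) digit_sumE ?ltn_pmod // digit_sum_small //.
by rewrite ltn_divLR // mulnn.
Qed.

Lemma digit_sum_two_digits_le b m : 1 < b -> m < b ^ 2 ->
  digit_sum b m <= 2 * b - 2.
Proof.
move=> b_gt1 m_lt; rewrite digit_sum_two_digits //.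
have b_gt0 : 0 < b by lia.
have := ltn_pmod m b_gt0.
by have : m %/ b < b; [rewrite ltn_divLR // mulnn | lia].
Qed.

(** Below [b.-1 ^ 2 = b.-2 * b + 1] the high digit is at most [b - 3], or it is
    [b - 2] and the low digit is 0. This saves 2 on the digit sum, which pays
    for the leading digit [a]. *)
Lemma digit_sum_window b k a x : 2 < b -> 1 < k -> a <= 2 -> x < b.-1 ^ 2 ->
  digit_sum b (a * b ^ k + x) <= 2 * b - 2.
Proof.
move=> b_gt2 k_gt1 a_le x_lt.
have b_gt1 : 1 < b by lia.
have x_lt2 : x < b ^ 2.
  by apply: (leq_trans x_lt); rewrite leq_exp2r ?leq_pred.
rewrite digit_sum_shift //; last by apply: (leq_trans x_lt2); rewrite leq_exp2l.
rewrite (digit_sum_two_digits b_gt1 x_lt2) digit_sum_small; last lia.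
have x_eq := divn_eq x b; have r_lt := @ltn_pmod x b (ltnW b_gt1).
have x_lt' : x < (b - 2) * b + 1.
  by apply: (leq_trans x_lt); rewrite -mulnn; nia.
have : x %/ b <= b - 2 by nia.
by rewrite leq_eqVlt => /orP[/eqP q_eq | q_lt]; [nia | lia].
Qed.

(** A number of [b, 2 * b - 2] is written [1 y] with [y <= b - 2]. *)
Lemma digit_sum_lt b m : 1 < b -> m <= 2 * b - 2 -> digit_sum b m < b.
Proof.
move=> b_gt1 m_le; case: (ltnP m b) => [m_lt | m_ge].
  by rewrite digit_sum_small.
have -> : m = 1 * b + (m - b) by lia.
by rewrite digit_sumE ?digit_sum_small; lia.
Qed.

(** * Bases at least 3 *)

(** Let [b ^ k <= S < b ^ k.+1]. When [S] lies beyond the window at [b ^ k] (or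
    at [2 * b ^ k]), the next window, at [2 * b ^ k] (or at [b ^ k.+1]), is
    within the range of pairs: that range falls short of [S * b.+1 / 2] because
    the last digit leads no pair, and having passed a whole window length
    [b.-1 ^ 2] makes up for this loss. *)
Lemma cuts_to_small_digit_sum b s : 2 < b -> all (fun d => d < b) s ->
  exists2 m, cuts_to b s m & digit_sum b m <= 2 * b - 2.
Proof.
move=> b_gt2 s_lt; have b_gt1 : 1 < b by lia.
set S := sumn s.
have window a k : 1 < k -> a <= 2 -> a * b ^ k <= S < a * b ^ k + b.-1 ^ 2 ->
    exists2 m, cuts_to b s m & digit_sum b m <= 2 * b - 2.
  move=> k_gt1 a_le S_in; exists S; first exact: cuts_to_sumn.
  by have := @digit_sum_window b k a (S - a * b ^ k); rewrite subnKC; lia.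
have reach a k : 1 < k -> a <= 2 ->
    S <= a * b ^ k <= S + b.-1 * uphalf (S - b.-1) ->
    exists2 m, cuts_to b s m & digit_sum b m <= 2 * b - 2.
  move=> k_gt1 a_le /(pairs_meet_window b_gt1 s_lt)[m m_s m_in].
  exists m => //.
  by have := @digit_sum_window b k a (m - a * b ^ k); rewrite subnKC; lia.
case: (ltnP S (b ^ 2)) => [S_lt | S_ge].
  by exists S; [exact: cuts_to_sumn | exact: digit_sum_two_digits_le].
have S_gt0 : 0 < S by apply: leq_trans S_ge; rewrite expn_gt0; lia.
pose k := trunc_log b S.
have /andP[low high] : b ^ k <= S < b ^ k.+1 by exact: trunc_log_bounds.
have k_gt1 : 1 < k by exact: trunc_log_max.
have double : 2 * uphalf (S - b.-1) >= S - b.-1 by lia.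
set u := uphalf _ in double *.
case: (ltnP S (b ^ k + b.-1 ^ 2)) => [S_lt1 | S_ge1].
  by apply: (window 1 k); lia.
case: (leqP S (2 * b ^ k)) => [S_le2 | S_gt2].
  apply: (reach 2 k) => //; rewrite S_le2 /=.
  have : 2 * u <= b.-1 * u by rewrite leq_mul2r; lia.
  have : b.-1 <= b.-1 ^ 2 by rewrite -mulnn leq_pmulr; lia.
  by rewrite -/u; lia.
case: (ltnP S (2 * b ^ k + b.-1 ^ 2)) => [S_lt2 | S_ge2].
  by apply: (window 2 k); lia.
apply: (reach 1 k.+1) => //; first lia.
rewrite mul1n (ltnW high) /= -/u expnS.
rewrite -mulnn in S_ge2; set P := b ^ k in low S_ge2 *.
by have [c b_eq] : exists c, b = c.+1; [exists b.-1; lia | subst b; nia].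
Qed.

(** * Base 2 *)

(** The bound [3 * t + 12 <= 4 * sumn s] is an invariant of the greedy step: a
    block of three digits starting with 1 lowers [t] by 4 and uses at most three
    ones, or lowers [t] by 3 and uses at most two. The constant 12 is the least
    one that leaves enough ones for pairs when [t] has come down to 3: it then
    forces [6 <= sumn s]. *)
Lemma bits_reach s t : all (fun d => d < 2) s -> 3 * t + 12 <= 4 * sumn s ->
  cuts_to 2 s (sumn s + t).
Proof.
elim: {s}(size s).+1 {-2}s (ltnSn (size s)) t => // n IH s size_s t s_lt t_le.
case: (leqP t 3) => [t_le3 | t_gt3].
  have [|v v_s v_eq] := @pairs_meet_window 2 s (sumn s + t) isT s_lt.
    by rewrite /= mul1n; lia.
  by have <- : v = sumn s + t by move: v_eq; rewrite /= exp1n; lia.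
case: s => [|x s] in size_s s_lt t_le *; first by move: t_le => /=; lia.
case: x => [|[|//]] in size_s s_lt t_le *.
  by apply: (@cuts_to_cons 2 0); apply: IH.
case: s => [|y [|z s]] in size_s s_lt t_le *; try by move: s_lt t_le => /=; lia.
move: s_lt => /= /and3P[y_lt z_lt s_lt].
have /(cuts_to_triple 1 y z) : cuts_to 2 s (sumn s + (t - (3 + y))).
  by apply: IH => //; [move: size_s | move: t_le] => /=; lia.
by congr cuts_to; move: t_le => /=; lia.
Qed.

(** A block 10x adds 3 to the digit sum. *)
Lemma one_or_block10 s : all (fun d => d < 2) s -> 0 < sumn s ->
  (exists s', s = 1 :: s') \/ cuts_to 2 (1 :: s) (4 + sumn s).
Proof.
case: s => [|[|[|//]] [|x s]] // _ _; try by left; eexists.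
right; have := cuts_to_triple 1 0 x (cuts_to_sumn 2 s).
by congr cuts_to; rewrite /=; lia.
Qed.

(** Without a block 10x the string is, up to leading zeros, 11111 followed by at
    most one 0. In 111110 three pairs start with 1; 11111 cannot reach 8, but
    1111 + 1 = 16. *)
Lemma five_bits_reach s : all (fun d => d < 2) s -> sumn s = 5 ->
  cuts_to 2 s 8 \/ cuts_to 2 s 16.
Proof.
elim: s => [|[|[|//]] s IH] //= s_lt s5.
  by case: (IH s_lt s5) => /(cuts_to_cons 0); [left | right].
have step s' n : all (fun d => d < 2) s' -> sumn s' = n.+1 ->
    (exists s'', [/\ s' = 1 :: s'', all (fun d => d < 2) s'' & sumn s'' = n])
    \/ cuts_to 2 (1 :: s') (n + 5).
  move=> s'_lt s'_sum; have [||[s'' s'_eq]|] := @one_or_block10 s'; rewrite ?s'_sum //.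
    by left; exists s''; move: s'_lt s'_sum; rewrite s'_eq /= => ->; split=> //; lia.
  by right; rewrite addnC.
have [[s1 [-> s1_lt s1_sum]]|] := step s 3 s_lt ltac:(lia); last by left.
have [[s2 [-> s2_lt s2_sum]]|] := step _ _ s1_lt s1_sum; last first.
  by move=> /(cuts_to_cons 1); left.
have [[s3 [-> s3_lt s3_sum]]|] := step _ _ s2_lt s2_sum; last first.
  by move=> /(cuts_to_cons 1)/(cuts_to_cons 1); left.
have [[s4 [-> s4_lt s4_sum]]|] := step _ _ s3_lt s3_sum; last first.
  by move=> /(cuts_to_cons 1)/(cuts_to_cons 1)/(cuts_to_cons 1); left.
case: s4 s4_sum {s4_lt} => [_ | x s4 /= s4_sum].
  by right; exists [:: [:: 1; 1; 1; 1]; [:: 1]]; rewrite big_cons big_seq1.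
left; have := cuts_to_sumn 2 s4.
move=> /(cuts_to_pair 1 x)/(cuts_to_pair 1 1)/(cuts_to_pair 1 1).
by congr cuts_to; lia.
Qed.

Lemma bits_cuts_to_pow2 s : all (fun d => d < 2) s -> 0 < sumn s ->
  exists k, cuts_to 2 s (2 ^ k).
Proof.
move=> s_lt s_gt0; set S := sumn s in s_gt0.
case: (leqP S 1) => [S_le1 | S_gt1].
  by exists 0; have -> : 2 ^ 0 = S by [lia]; exact: cuts_to_sumn.
case: (eqVneq S 5) => [S5 | S_neq5].
  by case: (five_bits_reach s_lt S5); [exists 3 | exists 4].
pose k := up_log 2 S; exists k.
have /andP[low high] : 2 ^ k.-1 < S <= 2 ^ k by exact: up_log_bounds.
have k_gt0 : 0 < k by rewrite up_log_gt0.
have pow_k : 2 ^ k = 2 * 2 ^ k.-1 by rewrite -expnS prednK.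
case: (leqP 6 S) => [S_ge6 | S_lt6].
  by rewrite -(subnKC high); apply: bits_reach => //; rewrite -/S; lia.
(* Up to 4 the deficit is at most 1, and a single pair makes up for it. *)
have [|v v_s v_eq] := @pairs_meet_window 2 s (2 ^ k) isT s_lt.
  rewrite -/S high /= mul1n.
  have : 2 ^ k.-1 <> 3 by case: (k.-1) => // j; rewrite expnS; lia.
  by lia.
by have <- : v = 2 ^ k by move: v_eq; rewrite /= exp1n; lia.
Qed.

(** * Counting the applications *)

Lemma partition_sum_digit_sum b n : partition_sum b n (digit_sum b n).
Proof. exact: cuts_to_sumn. Qed.

(** In base at least 3 the three applications are: a total of digit sum at most
    [2 * b - 2], then two digit sums. In base 2, for a positive number, the two
    applications are a power of 2, then its digit sum 1. *)
Theorem theorem1 :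
  (forall n : nat, single_digit_within 2 2 n) /\
  (forall b : nat, 3 <= b -> forall n : nat, single_digit_within b 3 n).
Proof.
split=> [n | b b_gt2 n].
  have [S0 | S_gt0] := posnP (digit_sum 2 n).
    exists 1, 0; split=> //; exists 0 => //.
    by have := partition_sum_digit_sum 2 n; rewrite S0.
  have [k n_k] := bits_cuts_to_pow2 (@all_digits_lt 2 n isT) S_gt0.
  exists 2, 1; split=> //; exists (2 ^ k) => //; exists 1 => //.
  have := partition_sum_digit_sum 2 (2 ^ k); congr partition_sum.
  have := @digit_sum_shift 2 k 1 0 isT; rewrite mul1n addn0 => -> //.
  by rewrite expn_gt0.
have b_gt1 : 1 < b by exact: ltnW.
have [m n_m m_le] := cuts_to_small_digit_sum b_gt2 (all_digits_lt n (ltnW b_gt1)).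
exists 3, (digit_sum b (digit_sum b m)); split; [by [] | | exact: digit_sum_lt].
exists m => //; exists (digit_sum b m); first exact: partition_sum_digit_sum.
exists (digit_sum b (digit_sum b m)) => //; exact: partition_sum_digit_sum.
Qed.
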